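(* Let $K=[-1,1]\times[0,1]\times[0,1]$ with generic point $\varpi=(w,p,q)$, let $\alpha_0\in(0,1]$, $\varepsilon>0$, and let $f_0\in P(K)$ be of the form $$ f_0=\alpha_0\,f_0^0(w,p)\,dw\,dp\otimes\delta_{q=0}+(1-\alpha_0)f_0^1, $$ where $f_0^0$ is a probability measure on $[-1,1]\times[0,1]$ and $$ f_0^1=\sum_{i=1}^N\alpha_i\,g_0^i(w)\,dw\otimes\delta_{p=p_i,\,q=q_i}, $$ with $N\in\mathbb{N}$, $\alpha_1,\dots,\alpha_N>0$, $\alpha_1+\dots+\alpha_N=1$, $q_1,\dots,q_N\in[\varepsilon,1]$ all distinct, $p_1,\dots,p_N\in(0,1]$, and $g_0^1,\dots,g_0^N\in P([-1,1])$. Let $\langle p\rangle_{q=0}:=\int_{-1}^1\int_0^1p\,df_0^0(w,p)$, assume $\langle p\rangle_{q=0}>0$, and put $$ m_0^0=\frac{1}{\langle p\rangle_{q=0}}\int_{-1}^1\int_0^1 p\,w\,df_0^0(w,p). $$ Let $f\in C([0,+\infty),P(K))$ be the solution, with initial condition $f_0$, of the nonlocal transport equation $\partial_tf_t+\partial_w\big((m(t)-w)\,q\,\langle p\rangle f_t\big)=0$, and let $f^1_t$ be its non-stubborn part, so that $f_t=\alpha_0f_0^0(w,p)\,dw\,dp\otimes\delta_{q=0}+(1-\alpha_0)f_t^1$ (see context for the precise definitions). Then $$ W_1\Big(f_t^1,\ \delta_{m_0^0}\otimes\sum_{i=1}^N\alpha_i\,\delta_{p=p_i,\,q=q_i}\Big)\to0\qquad\text{as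 }t\to+\infty. $$
   Context: $P(X)$ is the set of Borel probability measures on a compact metric space $X$; here $P(K)$ carries the topology of weak convergence. The Wasserstein distance $W_1(\mu,\nu)$ is the infimum of $\int |x-y|\,d\alpha(x,y)$ over couplings $\alpha$ of $\mu$ and $\nu$; equivalently, it is the supremum of $\int\varphi\,d(\mu-\nu)$ over $1$-Lipschitz $\varphi$. Notations such as $f_0^0(w,p)dwdp$ and $g_0^i(w)dw$ denote measures and do not mean that densities exist. Transport equation: given $f_0\in P(K)$, put $\langle p\rangle=\int_K p\,df_0$ and, for $f\in C([0,+\infty),P(K))$, $m(t)=\int_K\frac{p}{\langle p\rangle}w\,df_t(\varpi)$. Then $f$ solves $\partial_tf+\partial_w((m(t)-w)q\langle p\rangle f)=0$ with initial condition $f_0$ if for all $\phi\in C^\infty(K)$ and $t\ge0$, $$\int_K\phi\,df_t=\int_K\phi\,df_0+\int_0^t\int_K(m(s)-w)\langle p\rangle\,q\,\partial_w\phi(\varpi)\,df_s(\varpi)\,ds.$$ This equation has a unique solution in $C([0,+\infty),P(K))$ for every initial datum with $\langle p\rangle>0$. Non-stubborn part: $f^1_t\in P(K)$ denotes the evolution of $f_0^1$, i.e. $f^1\in C([0,+\infty),P(K))$, with $f^1_{t=0}=f_0^1$, is the weak solution of $\partial_tf^1_t+\partial_w((m(t)-w)q\langle p\rangle f^1_t)=0$, where $m(t)$ and $\langle p\rangle$ are those computed from the full solution $f$. One has $f_t=\alpha_0f_0^0\otimes\delta_{q=0}+(1-\alpha_0)f_t^1$, since agents with $q=0$ do not move;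 for $\alpha_0<1$ this identity determines $f^1_t$. *)

(* Defs.v *)
From HB Require Import structures.
From mathcomp Require Import all_boot all_order all_algebra.
From mathcomp Require Import all_classical all_reals all_analysis.

Set Implicit Arguments.
Unset Strict Implicit.
Unset Printing Implicit Defensive.

Import Order.TTheory GRing.Theory Num.Theory.
Import numFieldNormedType.Exports.

Local Open Scope classical_set_scope.
Local Open Scope ring_scope.

(* A point (w, p, q) is encoded as (w, (p, q)), so that x.1, x.2.1 and x.2.2
   are w, p and q. *)
Notation state R := (R * (R * R))%type.

Definition K (R : realType) : set (state R) :=
  `[-1, 1] `*` (`[0, 1] `*` `[0, 1]).
Arguments K {R}.

Definition Kwp (R : realType) : set (R * R) := `[-1, 1] `*` `[0, 1].
Arguments Kwp {R}.

Definition Kw (R : realType) : set R := `[-1, 1].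
Arguments Kw {R}.

(* P(X) for a compact box X of the ambient space is the set of Borel probability
   measures mu on the ambient space with mu X = 1. *)
Definition prob_on d (T : measurableType d) (R : realType) (X : set T)
  (mu : probability T R) : Prop := mu X = 1%E.

(* The probability measure \sum_i a i * mu i. *)
Section mixture.
Context d (T : measurableType d) (R : realType) (N : nat) (a : 'I_N -> R).
Context (a_gt0 : forall i, 0 < a i) (a_sum : \sum_(i < N) a i = 1).
Context (mu : 'I_N -> probability T R).

Definition mixture
  of (forall i, 0 < a i) & \sum_(i < N) a i = 1 : set T -> \bar R :=
  fun A => (\sum_(i < N) (a i)%:E * mu i A)%E.

Local Notation mix := (mixture a_gt0 a_sum).

Let mixture0 : mix set0 = 0%E.
Proof. by rewrite /mixture big1// => i _; rewrite measure0 mule0. Qed.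

Let mixture_ge0 A : (0 <= mix A)%E.
Proof.
by apply: sume_ge0 => i _; apply: mule_ge0 => //; rewrite lee_fin ltW.
Qed.

Let mixture_sigma_additive : semi_sigma_additive mix.
Proof.
move=> F mF tF mUF; rewrite /mixture.
under [X in X @ _ --> _]eq_fun.
  move=> n; rewrite exchange_big/=.
  under eq_bigr => i _ do (rewrite -ge0_sume_distrr; last by []).
  over.
apply: cvg_nnesum => i _.
  by apply: nearW => n; apply: mule_ge0;
    [rewrite lee_fin ltW | exact: sume_ge0].
by apply: cvgeZl => //; exact: measure_semi_sigma_additive.
Qed.

HB.instance Definition _ := isMeasure.Build _ _ _ mix
  mixture0 mixture_ge0 mixture_sigma_additive.

Let mixture_setT : mix setT = 1%E.
Proof.
rewrite /mixture; under eq_bigr do rewrite probability_setT mule1.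
by rewrite sumEFin a_sum.
Qed.

HB.instance Definition _ := Measure_isProbability.Build _ _ _ mix mixture_setT.
End mixture.

Fixpoint Ck (R : realType) (k : nat) (phi : state R -> R) : Prop :=
  if k is k'.+1 then
    (forall x, differentiable phi x) /\
    forall v : state R, Ck k' (fun x => 'D_v phi x)
  else continuous phi.

(* C^oo(K) is the set of restrictions to K of the functions smooth on R^3. *)
Definition smooth (R : realType) (phi : state R -> R) : Prop :=
  forall k, Ck k phi.

Definition dw (R : realType) (phi : state R -> R) : state R -> R :=
  fun x => 'D_((1, (0, 0)) : state R) phi x.

Definition weak_cvg (R : realType) (I : Type) (F : set_system I)
    (mu : I -> probability (state R) R) (nu : probability (state R) R) : Prop :=
  forall phi : state R -> R, {within K, continuous phi} ->
    (fun s => \int[mu s]_(x in K) phi x) @ F --> \int[nu]_(x in K) phi x.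

(* C([0, +oo), P(K)); curves are functions on R whose values at negative times
   are irrelevant. *)
Definition weakly_continuous (R : realType)
    (mu : R -> probability (state R) R) : Prop :=
  (forall t : R, 0 <= t -> prob_on K (mu t)) /\
  (forall t : R, 0 <= t -> weak_cvg (within `[0, +oo[ (nbhs t)) mu (mu t)).

(* mu solves d_t mu + d_w ((m(t) - w) q pbar mu) = 0, with initial datum mu0,
   for a given function m and a given constant pbar. *)
Definition weak_solution (R : realType) (m : R -> R) (pbar : R)
    (mu0 : probability (state R) R) (mu : R -> probability (state R) R) : Prop :=
  [/\ weakly_continuous mu,
      (forall A, measurable A -> mu 0 A = mu0 A) &
      forall phi, smooth phi -> forall t, 0 <= t ->
        \int[mu t]_(x in K) phi x =
        \int[mu0]_(x in K) phi x +
        \int[lebesgue_measure]_(s in `[0, t])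
          (\int[mu s]_(x in K) ((m s - x.1) * pbar * x.2.2 * dw phi x))].

Definition mean_p (R : realType) (f0 : probability (state R) R) : R :=
  \int[f0]_(x in K) x.2.1.

Definition mean_w (R : realType) (f0 : probability (state R) R)
    (f : R -> probability (state R) R) (t : R) : R :=
  \int[f t]_(x in K) (x.2.1 / mean_p f0 * x.1).

Definition transport_solution (R : realType) (f0 : probability (state R) R)
    (f : R -> probability (state R) R) : Prop :=
  weak_solution (mean_w f0 f) (mean_p f0) f0 f.

(* The linear equation for f1, with the m(t) and <p> of the full solution f;
   unlike the identity f_t = alpha0 f00 (x) delta_0 + (1 - alpha0) f1_t, it also
   determines f1 when alpha0 = 1. *)
Definition non_stubborn_part (R : realType) (f0 : probability (state R) R)
    (f : R -> probability (state R) R) (f01 : probability (state R) R)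
    (f1 : R -> probability (state R) R) : Prop :=
  weak_solution (mean_w f0 f) (mean_p f0) f01 f1.

(* The measure nu(dw, dp) (x) delta_{q = 0} in the coordinates (w, (p, q)). *)
Definition stubborn (R : realType) (nu : probability (R * R)%type R) :
    set (state R) -> \bar R :=
  pushforward (nu \x \d_(0%R : R))%E
    (fun z : (R * R) * R => (z.1.1, (z.1.2, z.2)) : state R).

(* Euclidean distance; the norm of the library on products is the sup norm. *)
Definition edist (R : realType) (x y : state R) : R :=
  Num.sqrt ((x.1 - y.1) ^+ 2 + (x.2.1 - y.2.1) ^+ 2 + (x.2.2 - y.2.2) ^+ 2).

Definition coupling (R : realType) (mu nu : probability (state R) R)
    (alpha : probability (state R * state R)%type R) : Prop :=
  forall A, measurable A ->
    pushforward alpha fst A = mu A /\ pushforward alpha snd A = nu A.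

Definition W1 (R : realType) (mu nu : probability (state R) R) : \bar R :=
  ereal_inf [set (\int[alpha]_z (edist z.1 z.2)%:E)%E |
    alpha in [set alpha | coupling mu nu alpha]].

(* Main.v *)
(* Every test function is a polynomial in (w, p, q), so the proof only handles
   moments.  The (p, q)-marginals are conserved; hence q f1_t-almost surely takes
   the values q_i only, and the moments of (w - m00) p H(q) under
   f_t - (1 - alpha0) f1_t solve linear equations that make the one with H = 1
   vanish.  In other words, with Y = int p (w - m00) df1_t,
     <p> (m(t) - m00) = (1 - alpha0) Y.
   Then E = int (p / q) (w - m00)^2 df1_t is a Lyapunov function: with
   Z = int p (w - m00)^2 df1_t and p1 = int p df1_t,
     E' = 2 (1 - alpha0) Y^2 - 2 <p> Z <= - 2 alpha0 <p>_{q=0} Z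
   by Cauchy-Schwarz (Y^2 <= p1 Z) and <p> = alpha0 <p>_{q=0} + (1 - alpha0) p1.
   Since Z >= eps E, the energy E tends to 0.  The map (w, p, q) -> (m00, p, q)
   transports f1_t to the target, at a cost controlled by E. *)

Require Import Defs.
From HB Require Import structures.
From mathcomp Require Import all_boot all_order all_algebra.
From mathcomp Require Import all_classical all_reals all_analysis.
From mathcomp Require Import measurable_realfun ring lra.

Set Implicit Arguments.
Unset Strict Implicit.
Unset Printing Implicit Defensive.

Import Order.TTheory GRing.Theory Num.Theory.
Import numFieldNormedType.Exports.

Local Open Scope classical_set_scope.
Local Open Scope ring_scope.

(** * Differential inequalities on the half-line *)

Section half_line.
Context {R : realType}.
Implicit Types (F G D : R -> R) (t : R).

(** The fundamental theorem of calculus turns the integral form of the equation into a derivative.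
    Time 0 is left out because the curves carry no information at negative times. *)
Lemma is_derive_primitive F (e : R -> R) (F0 t : R) :
  {within `[0, +oo[, continuous e} ->
  (forall t, 0 <= t -> F t = F0 + \int[lebesgue_measure]_(s in `[0, t]) e s) ->
  0 < t -> is_derive t 1 F (e t).
Proof.
move=> ce FE t0.
pose I t := \int[lebesgue_measure]_(s in `[0, t]) e s.
(* Integrating up to [t + 1] makes [t] an interior point of the interval. *)
have inte : lebesgue_measure.-integrable `[0, t + 1] (EFin \o e).
  apply: continuous_compact_integrable; first exact: segment_compact.
  by apply: continuous_subspaceW ce; exact: subset_itvl.
have tt1 : t < t + 1 by rewrite ltrDl.
have cet : {for t, continuous e}.
  apply: (@within_continuous_continuous _ _ _ 0 (t + 1)).
  - by rewrite addr_gt0.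
  - by apply: continuous_subspaceW ce; exact: subset_itvl.
  - by rewrite in_itv/= t0.
have [dI I't] : derivable I t 1 /\ derive1 I t = e t.
  by apply: (continuous_FTC1 tt1 inte) => //=; rewrite bnd_simp.
apply: (@near_eq_is_derive _ _ _ (fun s => F0 + I s)).
  by near=> s; rewrite FE//; apply: ltW; near: s; exact: lt_nbhsr.
rewrite -[e t]add0r; apply: is_deriveD.
apply: DeriveDef; first exact: dI.
by rewrite -derive1E I't.
Unshelve. all: by end_near. Qed.

Lemma nonincreasing_half_line D (d : R -> R) :
  {within `[0, +oo[, continuous D} ->
  (forall t, 0 < t -> is_derive t 1 D (d t)) ->
  (forall t, 0 < t -> d t <= 0) ->
  forall t, 0 <= t -> D t <= D 0.
Proof.
move=> cD dD d0 t t0.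
apply: (@ler0_derive1_nincry _ D 0) => // s; rewrite in_itv/= andbT => s0.
  by have [] := dD s s0.
by rewrite derive1E; have [_ ->] := dD s s0; exact: d0.
Qed.

Lemma constant_half_line D :
  {within `[0, +oo[, continuous D} ->
  (forall t, 0 < t -> is_derive t 1 D 0) -> forall t, 0 <= t -> D t = D 0.
Proof.
move=> cD dD t t0; apply/eqP; rewrite eq_le; apply/andP; split.
  exact: (nonincreasing_half_line cD dD).
rewrite -lerN2; apply: (@nonincreasing_half_line (\- D) (fun=> 0)) => //.
  by move=> x; apply: cvgN; exact: cD.
by move=> s s0; rewrite -[0]oppr0; apply: is_deriveN; exact: dD.
Qed.

(** The square of [D] has derivative [- 2 * a * D t ^+ 2], hence is nonincreasing, and it starts at
    0. *)
Lemma linear_ode_eq0 D (a : R) : 0 <= a ->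
  {within `[0, +oo[, continuous D} ->
  (forall t, 0 < t -> is_derive t 1 D (- a * D t)) ->
  D 0 = 0 -> forall t, 0 <= t -> D t = 0.
Proof.
move=> a0 cD dD D0 t t0.
have : D t * D t <= D 0 * D 0.
  apply: (@nonincreasing_half_line (D * D)
    (fun t => D t *: (- a * D t) + D t *: (- a * D t))) => //.
  - by move=> x; apply: cvgM; exact: cD.
  - by move=> s s0; apply: is_deriveM; exact: dD.
  - move=> s _; rewrite /GRing.scale/=.
    have : 0 <= a * D s ^+ 2 by rewrite mulr_ge0// sqr_ge0.
    lra.
rewrite D0 mulr0 -expr2 => /(conj (sqr_ge0 (D t)))/andP.
by rewrite -eq_le eq_sym sqrf_eq0 => /eqP.
Qed.

(** The product of [F t] with [1 + c * t] has derivative at most [- c ^+ 2 * t * F t], hence is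
    nonincreasing. For positive [c] this gives decay of order 1 / t, which suffices for convergence
    and spares the exponential. *)
Lemma gronwall_decay F (e : R -> R) (c : R) : 0 <= c ->
  {within `[0, +oo[, continuous F} ->
  (forall t, 0 < t -> is_derive t 1 F (e t)) ->
  (forall t, 0 <= t -> 0 <= F t) ->
  (forall t, 0 < t -> e t <= - c * F t) ->
  forall t, 0 <= t -> (1 + c * t) * F t <= F 0.
Proof.
move=> c0 cF dF F0 eF t t0.
pose G := (cst 1 + (c *: id)) * F.
have -> : F 0 = G 0 by change (F 0 = (1 + c * 0) * F 0); rewrite mulr0 addr0 mul1r.
apply: (@nonincreasing_half_line G
  (fun t => (1 + c * t) *: e t + F t *: (0 + c *: 1))); last exact: t0.
- move=> x; apply: cvgM; last exact: cF.
  have cl : continuous (fun t : R => 1 + c * t).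
    move=> y; apply: cvgD; first exact: cvg_cst.
    by apply: cvgM; [exact: cvg_cst|exact: cvg_id].
  exact: (continuous_subspaceT cl).
- move=> s s0; have dl : is_derive s 1 (cst 1 + (c *: id)) (0 + c *: 1) :=
    is_deriveD (is_derive_cst (1 : R) s 1) (is_deriveZ c (is_derive_id s 1)).
  exact: is_deriveM dl (dF s s0).
- move=> s s0; rewrite /GRing.scale/= add0r mulr1.
  have Fs := F0 s (ltW s0); have := eF s s0.
  have : 0 <= c * F s by rewrite mulr_ge0.
  have : 0 <= c * s by rewrite mulr_ge0// ltW.
  nra.
Qed.

End half_line.

(** * Polynomials in the state variables *)

Section polynomial_functions.
Context {R : realType}.
Implicit Types (phi psi : state R -> R) (x v : state R).

(** Polynomials are given by their formation rules, so that smoothness, measurability and bounds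
    follow by induction, while membership goals are settled by [auto] with the hints below. *)
Inductive polyfun : (state R -> R) -> Prop :=
| polyfun_cst c : polyfun (fun=> c)
| polyfun_w : polyfun (fun x => x.1)
| polyfun_p : polyfun (fun x => x.2.1)
| polyfun_q : polyfun (fun x => x.2.2)
| polyfunD phi psi : polyfun phi -> polyfun psi ->
    polyfun (fun x => phi x + psi x)
| polyfunM phi psi : polyfun phi -> polyfun psi ->
    polyfun (fun x => phi x * psi x).

(** The coordinates are bundled as linear maps so that the differentiability of continuous linear
    maps applies to them. *)
Let pw : {linear state R -> R} := fst.
Let pp : {linear state R -> R} := fst \o snd.
Let pq : {linear state R -> R} := snd \o snd.

Let cpw : continuous pw. Proof. by move=> x; exact: cvg_fst. Qed.

Let cpp : continuous pp.
Proof. by move=> x; apply: continuous_comp; [exact: cvg_snd|exact: cvg_fst]. Qed.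

Let cpq : continuous pq.
Proof. by move=> x; apply: continuous_comp; exact: cvg_snd. Qed.

Lemma polyfun_differentiable phi x : polyfun phi -> differentiable phi x.
Proof.
elim=> [c||||f g _ df _ dg|f g _ df _ dg].
- exact: differentiable_cst.
- exact: (linear_differentiable x cpw).
- exact: (linear_differentiable x cpp).
- exact: (linear_differentiable x cpq).
- exact: differentiableD.
- exact: differentiableM.
Qed.

Lemma polyfun_continuous phi : polyfun phi -> continuous phi.
Proof.
by move=> pphi x; exact/differentiable_continuous/polyfun_differentiable.
Qed.

Lemma polyfun_measurable phi (D : set (state R)) :
  polyfun phi -> measurable_fun D phi.
Proof.
move=> pphi; apply: measurable_funTS; elim: pphi => [c||||f g _ mf _ mg|f g _ mf _ mg].
- exact: measurable_cst.
- exact: measurable_fst.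
- exact: (measurableT_comp measurable_fst measurable_snd).
- exact: (measurableT_comp measurable_snd measurable_snd).
- exact: measurable_funD.
- exact: measurable_funM.
Qed.

Lemma derive_w v x : 'D_v (fun x : state R => x.1) x = v.1.
Proof.
by rewrite deriveE ?(diff_lin x cpw)//; exact: linear_differentiable x cpw.
Qed.

Lemma derive_p v x : 'D_v (fun x : state R => x.2.1) x = v.2.1.
Proof.
by rewrite deriveE ?(diff_lin x cpp)//; exact: linear_differentiable x cpp.
Qed.

Lemma derive_q v x : 'D_v (fun x : state R => x.2.2) x = v.2.2.
Proof.
by rewrite deriveE ?(diff_lin x cpq)//; exact: linear_differentiable x cpq.
Qed.

Lemma derive_polyfunD phi psi v x : polyfun phi -> polyfun psi ->
  'D_v (fun x => phi x + psi x) x = 'D_v phi x + 'D_v psi x.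
Proof.
by move=> hphi hpsi; rewrite -deriveD//;
  exact/diff_derivable/polyfun_differentiable.
Qed.

Lemma derive_polyfunM phi psi v x : polyfun phi -> polyfun psi ->
  'D_v (fun x => phi x * psi x) x = phi x * 'D_v psi x + psi x * 'D_v phi x.
Proof.
by move=> hphi hpsi; rewrite -[RHS]deriveM//;
  exact/diff_derivable/polyfun_differentiable.
Qed.

Lemma polyfun_derive phi v : polyfun phi -> polyfun (fun x => 'D_v phi x).
Proof.
elim=> [c||||f g pf pdf pg pdg|f g pf pdf pg pdg].
- under eq_fun do rewrite derive_cst; exact: polyfun_cst.
- under eq_fun do rewrite derive_w; exact: polyfun_cst.
- under eq_fun do rewrite derive_p; exact: polyfun_cst.
- under eq_fun do rewrite derive_q; exact: polyfun_cst.
- under eq_fun do rewrite derive_polyfunD//; exact: polyfunD.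
- under eq_fun do rewrite derive_polyfunM//.
  by apply: polyfunD; apply: polyfunM.
Qed.

(** Directional derivatives of polynomials are polynomials, so the induction on the order of
    smoothness runs over all polynomials at once. *)
Lemma polyfun_smooth phi : polyfun phi -> smooth phi.
Proof.
move=> pphi k; elim: k phi pphi => [|k IHk] phi pphi/=.
  exact: polyfun_continuous.
split=> [x|v]; first exact: polyfun_differentiable.
exact/IHk/polyfun_derive.
Qed.

Lemma polyfun_bounded phi : polyfun phi ->
  exists C, forall x, K x -> `|phi x| <= C.
Proof.
elim=> [c||||f g _ [C hC] _ [C' hC']|f g _ [C hC] _ [C' hC']].
- by exists `|c|.
- by exists 1 => x [/=]; rewrite in_itv/= ler_norml.
- exists 1 => x [/= _ [/=]]; rewrite !in_itv/= ler_norml => /andP[x0 ->] _.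
  by rewrite andbT (le_trans _ x0)// lerN10.
- exists 1 => x [/= _ [/= _]]; rewrite !in_itv/= ler_norml => /andP[x0 ->].
  by rewrite andbT (le_trans _ x0)// lerN10.
- exists (C + C') => x Kx; rewrite (le_trans (ler_normD _ _))//.
  by rewrite lerD ?hC ?hC'.
- by exists (C * C') => x Kx; rewrite normrM ler_pM ?hC ?hC'.
Qed.

Lemma measurable_K : measurable (@K R).
Proof. by do 2 (apply: measurableX => //). Qed.

Lemma polyfunN phi : polyfun phi -> polyfun (fun x => - phi x).
Proof.
move=> pphi; under eq_fun do rewrite -mulN1r.
by apply: polyfunM => //; exact: polyfun_cst.
Qed.

Lemma polyfunB phi psi : polyfun phi -> polyfun psi ->
  polyfun (fun x => phi x - psi x).
Proof. by move=> pphi ppsi; apply: polyfunD => //; exact: polyfunN. Qed.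

Lemma polyfunX phi n : polyfun phi -> polyfun (fun x => phi x ^+ n).
Proof.
move=> pphi; elim: n => [|n IHn]; first exact: polyfun_cst.
by under eq_fun do rewrite exprS; exact: polyfunM.
Qed.

Lemma polyfun_prod (I : Type) (s : seq I) (P : pred I) (F : I -> state R -> R) :
  (forall i, polyfun (F i)) -> polyfun (fun x => \prod_(i <- s | P i) F i x).
Proof.
move=> pF; elim: s => [|i s IHs].
  by under eq_fun do rewrite big_nil; exact: polyfun_cst.
under eq_fun do rewrite big_cons.
by case: (P i) => //; exact: polyfunM.
Qed.

Lemma polyfun_sum (I : Type) (s : seq I) (P : pred I) (F : I -> state R -> R) :
  (forall i, polyfun (F i)) -> polyfun (fun x => \sum_(i <- s | P i) F i x).
Proof.
move=> pF; elim: s => [|i s IHs].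
  by under eq_fun do rewrite big_nil; exact: polyfun_cst.
under eq_fun do rewrite big_cons.
by case: (P i) => //; exact: polyfunD.
Qed.

End polynomial_functions.

#[export] Hint Resolve polyfun_cst polyfun_w polyfun_p polyfun_q
  polyfunD polyfunM polyfunN polyfunB polyfunX polyfun_prod
  polyfun_sum : core.

(** * Moments and the Cauchy-Schwarz inequality *)

Section moments.
Context {R : realType}.
Implicit Types (phi psi : state R -> R) (x : state R) (mu : probability (state R) R).

Definition moment mu phi : R := \int[mu]_(x in K) phi x.

Lemma integrable_polyfun mu phi : polyfun phi -> mu.-integrable K (EFin \o phi).
Proof.
move=> pphi; apply: measurable_bounded_integrable.
- exact: measurable_K.
- by apply: le_lt_trans (ltry 1); exact: (probability_le1 _ measurable_K).
- exact: polyfun_measurable.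
- have [C hC] := polyfun_bounded pphi.
  by exists C; split => [|M CM x /hC xC]; [exact: num_real|exact: le_trans (ltW CM)].
Qed.

Lemma momentD mu phi psi : polyfun phi -> polyfun psi ->
  moment mu (fun x => phi x + psi x) = moment mu phi + moment mu psi.
Proof.
by move=> *; apply: RintegralD;
  by [exact: measurable_K|exact: integrable_polyfun].
Qed.

Lemma momentB mu phi psi : polyfun phi -> polyfun psi ->
  moment mu (fun x => phi x - psi x) = moment mu phi - moment mu psi.
Proof.
by move=> *; apply: RintegralB;
  by [exact: measurable_K|exact: integrable_polyfun].
Qed.

Lemma momentZ mu c phi : polyfun phi ->
  moment mu (fun x => c * phi x) = c * moment mu phi.
Proof.
by move=> *; apply: RintegralZl;
  by [exact: measurable_K|exact: integrable_polyfun].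
Qed.

Lemma moment_cst mu c : prob_on K mu -> moment mu (fun=> c) = c.
Proof.
move=> muK; rewrite /moment Rintegral_cst; last exact: measurable_K.
by transitivity (c * fine 1%E); [congr (c * fine _)|rewrite mulr1].
Qed.

Lemma eq_moment mu phi psi : (forall x, K x -> phi x = psi x) ->
  moment mu phi = moment mu psi.
Proof. by move=> h; apply: eq_Rintegral => x; rewrite inE => /h. Qed.

Lemma moment_ge0 mu phi : (forall x, K x -> 0 <= phi x) -> 0 <= moment mu phi.
Proof. exact: Rintegral_ge0. Qed.

(** For [a > 0] the quadratic is evaluated at its minimiser [- b / a]; for [a = 0] it is affine, and
    nonnegative everywhere only if [b = 0]. *)
Lemma discriminant_le0 (a b c : R) : 0 <= a ->
  (forall l, 0 <= a * l ^+ 2 + 2 * b * l + c) -> b ^+ 2 <= a * c.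
Proof.
rewrite le_eqVlt => /predU1P[<-|a0] h; last first.
  have := h (- b / a).
  rewrite (_ : a * _ + _ + _ = (a * c - b ^+ 2) / a); last by field; rewrite gt_eqF.
  by rewrite pmulr_lge0 ?invr_gt0// subr_ge0.
rewrite mul0r; have [->|b0] := eqVneq b 0; first by rewrite expr0n.
  (* At this point the affine function takes the value -1. *)
  have := h (- (c + 1) / (2 * b)); rewrite mul0r add0r.
  by rewrite (_ : _ + _ = - 1); [lra|field].
Qed.

(** For every l the moment of rho (l phi + psi)^2 is nonnegative; its discriminant as a quadratic in
    l yields the inequality. *)
Lemma moment_cauchy_schwarz mu rho phi psi :
  polyfun rho -> polyfun phi -> polyfun psi ->
  (forall x, K x -> 0 <= rho x) ->
  moment mu (fun x => rho x * (phi x * psi x)) ^+ 2 <=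
  moment mu (fun x => rho x * phi x ^+ 2) * moment mu (fun x => rho x * psi x ^+ 2).
Proof.
move=> prho pphi ppsi rho0; apply: discriminant_le0 => [|l].
  by apply: moment_ge0 => x Kx; rewrite mulr_ge0 ?rho0// sqr_ge0.
rewrite [X in 0 <= X](_ : _ = moment mu (fun x => rho x * (l * phi x + psi x) ^+ 2)).
  by apply: moment_ge0 => x Kx; rewrite mulr_ge0 ?rho0// sqr_ge0.
rewrite [RHS](@eq_moment _ _ (fun x => (l ^+ 2) * (rho x * phi x ^+ 2) +
   (2 * l) * (rho x * (phi x * psi x)) + rho x * psi x ^+ 2)); last by move=> x _; ring.
rewrite !momentD ?momentZ; auto 10.
ring.
Qed.

(** Cauchy-Schwarz with weight 1. It exploits that [chi] vanishes almost surely while speaking of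
    moments only. *)
Lemma moment_mul_eq0 mu phi chi : polyfun phi -> polyfun chi ->
  moment mu (fun x => chi x ^+ 2) = 0 -> moment mu (fun x => phi x * chi x) = 0.
Proof.
move=> pphi pchi chi0.
have := @moment_cauchy_schwarz mu (fun=> 1) phi chi (polyfun_cst 1) pphi pchi.
move=> /(_ (fun _ _ => ler01)).
under [X in X ^+ 2]eq_moment do rewrite mul1r.
under [X in _ * X]eq_moment do rewrite mul1r.
rewrite chi0 mulr0 => h; apply/eqP; rewrite -sqrf_eq0 eq_le h; exact: sqr_ge0.
Qed.

End moments.

(** * Evolution of moments along weak solutions *)

Section transport.
Context {R : realType}.
Implicit Types (phi : state R -> R) (x : state R) (t : R).

(** The direction [(1, (0, 0))] leaves (p, q) unchanged, so every difference quotient is 0, whatever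
    [h] is. *)
Lemma dw_snd (h : R * R -> R) x : dw (fun x => h x.2) x = 0.
Proof.
rewrite /dw /derive; apply: lim_near_cst => //=.
near=> r.
rewrite [X in h X - _](_ : _ = x.2) ?subrr ?scaler0//.
by rewrite /= add0r.
Unshelve. all: by end_near. Qed.

Lemma dw_affine (c : R) (h : R * R -> R) x : polyfun (fun x => h x.2) ->
  dw (fun x => (x.1 - c) * h x.2) x = h x.2.
Proof.
move=> ph; rewrite /dw derive_polyfunM; [|exact: polyfunB|exact: ph].
have /= := dw_snd h x; rewrite /dw => ->.
rewrite (_ : (fun x => x.1 - c) = (fun x : state R => x.1 + (fun=> - c) x))//.
rewrite derive_polyfunD// derive_w derive_cst/=.
by rewrite mulr0 add0r addr0 mulr1.
Qed.

Lemma dw_quadratic (c : R) (h : R * R -> R) x : polyfun (fun x => h x.2) ->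
  dw (fun x => (x.1 - c) ^+ 2 * h x.2) x = 2 * ((x.1 - c) * h x.2).
Proof.
move=> ph.
rewrite (_ : (fun x => _) = (fun x => (x.1 - c) * ((x.1 - c) * h x.2))); last first.
  by apply/funext => y; rewrite expr2 mulrA.
rewrite /dw derive_polyfunM; auto.
have := dw_affine c x ph; rewrite /dw => ->.
have := @dw_affine c (fun=> 1) x (polyfun_cst 1); rewrite /dw.
under eq_fun do rewrite mulr1.
by move=> ->; ring.
Qed.

Context (m : R -> R) (pbar : R) (mu0 : probability (state R) R)
  (mu : R -> probability (state R) R).
Hypothesis sol : weak_solution m pbar mu0 mu.

Lemma moment_at0 phi : moment (mu 0) phi = moment mu0 phi.
Proof.
have [_ mu00 _] := sol; rewrite /moment /Rintegral; congr fine.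
by apply: eq_measure_integral => A mA _; exact: mu00.
Qed.

Lemma prob_on_solution t : 0 <= t -> prob_on K (mu t).
Proof. by case: sol => -[+ _] _ _; apply. Qed.

Lemma moment_continuous phi : polyfun phi ->
  {within `[0, +oo[, continuous (fun t => moment (mu t) phi)}.
Proof.
move=> pphi; apply/subspace_continuousP => t /=; rewrite in_itv/= andbT => t0.
have [[_ cmu] _ _] := sol; apply: (cmu t t0 phi).
exact/continuous_subspaceT/polyfun_continuous.
Qed.

(** The right-hand side of the weak formulation with [pbar] and [m t] pulled out of the integral:
    only moments of time-independent polynomials remain when [phi] is a polynomial. *)
Definition flux phi t : R := pbar * (m t * moment (mu t) (fun x => x.2.2 * dw phi x)
  - moment (mu t) (fun x => x.1 * (x.2.2 * dw phi x))).

Lemma moment_integral_equation phi t : polyfun phi -> 0 <= t ->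
  moment (mu t) phi =
  moment mu0 phi + \int[lebesgue_measure]_(s in `[0, t]) flux phi s.
Proof.
move=> pphi t0; have [_ _ /(_ phi (polyfun_smooth pphi) t t0)] := sol.
rewrite /moment => ->; congr (_ + _); apply: eq_Rintegral => s _.
have pd : polyfun (fun x => x.2.2 * dw phi x).
  by apply: polyfunM => //; exact: polyfun_derive.
rewrite /flux -momentZ//.
rewrite -momentB; [|exact: polyfunM|exact: polyfunM].
rewrite -momentZ; last by apply: polyfunB; exact: polyfunM.
by apply: eq_moment => x _; ring.
Qed.

(** Transport acts along w only, so the flux of a function of (p, q) vanishes. *)
Lemma moment_conserved (h : R * R -> R) t : polyfun (fun x => h x.2) -> 0 <= t ->
  moment (mu t) (fun x => h x.2) = moment mu0 (fun x => h x.2).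
Proof.
move=> ph t0; rewrite moment_integral_equation//.
rewrite (@eq_Rintegral _ _ _ _ _ (fun=> 0)) => [|s _].
  by rewrite Rintegral_cst//= mul0r addr0.
rewrite /flux (@eq_moment _ _ _ (fun=> 0)) => [|x _]; last by rewrite dw_snd mulr0.
rewrite (@eq_moment _ _ (fun x => _ * (_ * _)) (fun=> 0)) => [|x _]; last first.
  by rewrite dw_snd !mulr0.
by rewrite /moment/= !Rintegral_cst ?mul0r ?subr0 ?mulr0//; exact: measurable_K.
Qed.

Hypothesis mc : {within `[0, +oo[, continuous m}.

Lemma flux_continuous phi : polyfun phi ->
  {within `[0, +oo[, continuous (flux phi)}.
Proof.
move=> pphi; have pd : polyfun (fun x => x.2.2 * dw phi x).
  by apply: polyfunM => //; exact: polyfun_derive.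
have pd' := polyfunM polyfun_w pd.
move=> t; apply: cvgM; first exact: cvg_cst.
apply: cvgB; last exact: (moment_continuous pd').
by apply: cvgM; [exact: mc|exact: (moment_continuous pd)].
Qed.

Lemma moment_is_derive phi t : polyfun phi -> 0 < t ->
  is_derive t 1 (fun t => moment (mu t) phi) (flux phi t).
Proof.
move=> pphi t0; apply: (is_derive_primitive (flux_continuous pphi) _ t0).
by move=> s s0; exact: moment_integral_equation.
Qed.

End transport.

(** * Measures with an atomic (p, q)-marginal *)

Section atomic_marginal.
Context {R : realType} (N : nat) (alpha p q : 'I_N -> R).
Context (mu : probability (state R) R) (muK : prob_on K mu).
Hypothesis marginal : forall h : R * R -> R, polyfun (fun x => h x.2) ->
  moment mu (fun x => h x.2) = \sum_(i < N) alpha i * h (p i, q i).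

(** A nonnegative polynomial whose zeros are exactly the nodes [(p i, q i)]. Its moment is 0, which
    confines [mu] to the fibres over the nodes. *)
Let chi (y : R * R) : R :=
  \prod_(i < N) ((y.1 - p i) ^+ 2 + (y.2 - q i) ^+ 2).

Let polyfun_chi : polyfun (fun x => chi x.2).
Proof. by apply: polyfun_prod => i; auto 10. Qed.

Let chi_ge0 y : 0 <= chi y.
Proof. by apply: prodr_ge0 => i _; rewrite addr_ge0 ?sqr_ge0. Qed.

Let chi_atom i : chi (p i, q i) = 0.
Proof. by rewrite /chi (bigD1 i)//= !subrr !expr0n/= addr0 mul0r. Qed.

Let chi_eq0 y : chi y = 0 -> exists i, y = (p i, q i).
Proof.
move/eqP/prodf_eq0 => [i _]; rewrite paddr_eq0 ?sqr_ge0// !sqrf_eq0 !subr_eq0.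
by case: y => a b /= /andP[/eqP -> /eqP ->]; exists i.
Qed.

Definition atoms : set (state R) := K `&` [set x | exists i, x.2 = (p i, q i)].

Let off : set (state R) := K `&` (fun x => chi x.2) @^-1` [set~ 0].

Let atomsE : atoms = K `\` off.
Proof.
apply/seteqP; split => x /=.
  by move=> [Kx [i xi]]; split => // -[_ /=]; rewrite xi chi_atom.
move=> [Kx /not_andP[//|/contrapT/= x0]]; split => //; exact: chi_eq0.
Qed.

Let measurable_off : measurable off.
Proof.
apply: (polyfun_measurable polyfun_chi measurable_K).
by apply: measurableC; exact: measurable_set1.
Qed.

Lemma measurable_atoms : measurable atoms.
Proof. by rewrite atomsE; apply: measurableD => //; exact: measurable_K. Qed.

Let mu_off : mu off = 0%E.
Proof.
have m0 : moment mu (fun x => chi x.2) = 0.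
  by rewrite marginal// big1// => i _; rewrite chi_atom mulr0.
have int0 : (\int[mu]_(x in K) (chi x.2)%:E = 0)%E.
  rewrite -[LHS]fineK; first exact: (congr1 EFin m0).
  by apply: integrable_fin_num; [exact: measurable_K|exact: integrable_polyfun].
have h : ae_eq mu K (fun x => (chi x.2)%:E) (cst 0%E).
  apply/(ae_eq_integral_abs mu measurable_K).
    by apply/measurable_EFinP; exact: polyfun_measurable.
  rewrite -[RHS]int0; apply: eq_integral => x _.
  by rewrite gee0_abs// lee_fin.
apply/negligibleP => //; apply: negligibleS h.
by move=> x [Kx /= /eqP x0] /(_ Kx)[/eqP]; exact/negP.
Qed.

Lemma mu_atoms : mu atoms = 1%E.
Proof.
rewrite atomsE.
have muK1 : mu K = 1%E := muK.
have e : mu K = (mu (K `\` off) + mu (K `&` off))%E.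
  exact: measureDI measurable_K measurable_off.
by rewrite -muK1 e /off setIA setIid -/off mu_off adde0.
Qed.

Lemma moment_atoms phi : polyfun phi ->
  moment mu phi = \int[mu]_(x in atoms) phi x.
Proof.
move=> pphi; rewrite /moment /Rintegral atomsE; congr fine.
apply: negligible_integral => //; [exact: measurable_K|exact: integrable_polyfun].
Qed.

Let integrable_atoms phi : polyfun phi -> mu.-integrable atoms (EFin \o phi).
Proof.
move=> pphi; apply: (integrableS measurable_K) => //.
- exact: measurable_atoms.
- by move=> x [].
- exact: integrable_polyfun.
Qed.

(** The measure is carried by [atoms], so polynomials need to be compared over the nodes only. This
    allows a polynomial that equals 1 / q merely at the nodes to stand for 1 / q under the
    integral. *)
Lemma le_moment_atoms phi psi : polyfun phi -> polyfun psi ->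
  (forall x i, K x -> x.2 = (p i, q i) -> phi x <= psi x) ->
  moment mu phi <= moment mu psi.
Proof.
move=> pphi ppsi le; rewrite !moment_atoms//; apply: le_Rintegral.
- exact: measurable_atoms.
- exact: integrable_atoms.
- exact: integrable_atoms.
- by move=> x [Kx [i]]; exact: le.
Qed.

Lemma eq_moment_atoms phi psi : polyfun phi -> polyfun psi ->
  (forall x i, K x -> x.2 = (p i, q i) -> phi x = psi x) ->
  moment mu phi = moment mu psi.
Proof.
move=> pphi ppsi e; apply/eqP; rewrite eq_le.
by apply/andP; split; apply: le_moment_atoms => // x i Kx /(e x i Kx) ->.
Qed.

Hypothesis q_inj : injective q.

(** The Lagrange basis in the variable q alone; it separates the nodes because the [q i] are
    distinct. *)
Let lagrange i (y : R * R) : R :=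
  \prod_(j < N | j != i) ((y.2 - q j) * (q i - q j)^-1).

Let lagrangeE i j : lagrange i (p j, q j) = (i == j)%:R.
Proof.
rewrite /lagrange; have [<-|ij] := eqVneq i j.
  apply: big1 => k ki; rewrite divff// subr_eq0.
  by apply: contra ki => /eqP/q_inj ->.
by rewrite (bigD1 j) 1?eq_sym//= subrr !mul0r.
Qed.

(** Over the nodes the indicator of [A] coincides with its Lagrange interpolant [h], a polynomial,
    so the formula for polynomial moments passes to measurable sets. *)
Lemma snd_marginal (A : set (R * R)) : measurable A ->
  mu (snd @^-1` A) = (\sum_(i < N) (alpha i)%:E * \d_(p i, q i) A)%E.
Proof.
move=> mA.
pose h y := \sum_(i < N) (\1_A (p i, q i) * lagrange i y).
have ph : polyfun (fun x : state R => h x.2).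
  apply: polyfun_sum => i; apply: polyfunM => //.
  by apply: polyfun_prod => j; auto 10.
have hE i : h (p i, q i) = \1_A (p i, q i).
  rewrite /h (bigD1 i)//= lagrangeE eqxx mulr1 big1 ?addr0// => j ji.
  by rewrite lagrangeE (negbTE ji) mulr0.
have mA' : measurable (snd @^-1` A : set (state R)).
  by rewrite -[X in measurable X]setTI; exact: measurable_snd.
transitivity (moment mu (fun x => h x.2))%:E.
  rewrite moment_atoms// /Rintegral fineK; last first.
    by apply: integrable_fin_num; [exact: measurable_atoms|exact: integrable_atoms].
  transitivity (\int[mu]_(x in atoms) (\1_(snd @^-1` A) x)%:E)%E.
    rewrite integral_indic//; last exact: measurable_atoms.
    have -> : mu (snd @^-1` A) =
        (mu (snd @^-1` A `\` atoms) + mu (snd @^-1` A `&` atoms))%E.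
      exact: measureDI mA' measurable_atoms.
    have -> : mu (snd @^-1` A `\` atoms) = 0%E.
      apply: (@subset_measure0 _ _ _ mu _ (~` atoms)).
      - by apply: measurableD => //; exact: measurable_atoms.
      - by apply: measurableC; exact: measurable_atoms.
      - by move=> x [].
      - rewrite -[LHS]/(mu _) probability_setC ?mu_atoms ?subee//.
        exact: measurable_atoms.
    by rewrite add0e.
  apply: eq_integral => x; rewrite inE => -[_ [i xi]].
  rewrite xi hE !indicE -xi; congr ((nat_of_bool _)%:R%:E).
by rewrite marginal// -sumEFin; apply: eq_bigr => i _; rewrite hE EFinM diracE indicE.
Qed.

End atomic_marginal.

(** * A coupling bound for the Wasserstein distance *)

Section wasserstein_fibre.
Context {R : realType}.

(* [edist] alone would denote the extended distance of the library. *)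
Lemma measurable_edist :
  measurable_fun setT (fun z : state R * state R => Defs.edist z.1 z.2).
Proof.
apply: (measurableT_comp (continuous_measurable_fun (@sqrt_continuous R))).
apply: measurable_funD; first apply: measurable_funD;
  apply: measurable_funX; apply: measurable_funB.
- exact: (measurableT_comp measurable_fst measurable_fst).
- exact: (measurableT_comp measurable_fst measurable_snd).
- exact: (measurableT_comp (measurableT_comp measurable_fst measurable_snd) measurable_fst).
- exact: (measurableT_comp (measurableT_comp measurable_fst measurable_snd) measurable_snd).
- exact: (measurableT_comp (measurableT_comp measurable_snd measurable_snd) measurable_fst).
- exact: (measurableT_comp (measurableT_comp measurable_snd measurable_snd) measurable_snd).
Qed.

(** The graph of the map that moves w to [a] and keeps (p, q). The image of [mu] under it is the
    coupling used below. *)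
Definition fibre_map (a : R) (x : state R) : state R * state R := (x, (a, x.2)).

Lemma measurable_fibre_map a : measurable_fun setT (fibre_map a).
Proof.
apply: measurable_fun_pair => //; apply: measurable_fun_pair => //.
Qed.

HB.instance Definition _ a :=
  isMeasurableFun.Build _ _ _ _ (fibre_map a) (measurable_fibre_map a).

Lemma W1_ge0 (mu nu : probability (state R) R) : (0 <= W1 mu nu)%E.
Proof.
apply: le_ereal_inf_tmp => _ [gamma _ <-]; apply: integral_ge0 => z _.
by rewrite lee_fin sqrtr_ge0.
Qed.

(** The coupling along the fibres costs the integral of |w - a|, and |w - a| <= delta + |w - a|^2 /
    delta. The free parameter [delta] bounds the cost by a polynomial moment, without a square
    root. *)
Lemma W1_fibre (mu nu : probability (state R) R) (a delta : R) :
  prob_on K mu -> 0 < delta ->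
  (forall A, measurable A -> nu A = mu [set x | A (a, x.2)]) ->
  (W1 mu nu <= (delta + delta^-1 * moment mu (fun x => (x.1 - a) ^+ 2))%:E)%E.
Proof.
move=> muK d0 nuE.
have psq : polyfun (fun x : state R => (x.1 - a) ^+ 2) by auto.
have pb : polyfun (fun x : state R => delta + delta^-1 * (x.1 - a) ^+ 2) by auto.
apply: (@le_trans _ _ (\int[mu]_x (Defs.edist x (a, x.2))%:E)%E).
  apply: ereal_inf_lbound; exists (distribution mu (fibre_map a)).
    by move=> A mA; split => //; rewrite nuE.
  rewrite ge0_integral_pushforward//.
  - by apply/measurable_EFinP; exact: measurable_edist.
  - by move=> z _; rewrite lee_fin sqrtr_ge0.
have mT : measurable_fun setT (fun x : state R => (Defs.edist x (a, x.2))%:E).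
  apply/measurable_EFinP.
  exact: (measurableT_comp measurable_edist (measurable_fibre_map a)).
(* The cost is integrated over the whole space and moments over [K]; the complement of [K] is
   null. *)
rewrite (@ge0_negligible_integral _ _ _ mu setT (~` K))//; last 3 first.
- by apply: measurableC; exact: measurable_K.
- by move=> x _; rewrite lee_fin sqrtr_ge0.
- rewrite -[LHS]/(mu _) probability_setC ?[mu K]muK ?subee//; exact: measurable_K.
rewrite setTD setCK.
have -> : (delta + delta^-1 * moment mu (fun x => (x.1 - a) ^+ 2))%:E =
    (\int[mu]_(x in K) (delta + delta^-1 * (x.1 - a) ^+ 2)%:E)%E.
  rewrite -momentZ// -{1}(moment_cst delta muK) -momentD; auto.
  rewrite /moment /Rintegral fineK//.
  exact: (integrable_fin_num measurable_K (integrable_polyfun mu pb)).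
apply: ge0_le_integral.
- exact: measurable_K.
- by move=> x _; rewrite lee_fin sqrtr_ge0.
- exact: measurable_funTS.
- by apply/measurable_EFinP; exact: polyfun_measurable.
- move=> x _; rewrite lee_fin /Defs.edist/= !subrr expr0n/= !addr0 sqrtr_sqr.
  have -> : (x.1 - a) ^+ 2 = `|x.1 - a| ^+ 2 by rewrite real_normK ?num_real.
  set u := `|_|.
  rewrite -(ler_pM2l d0) mulrDr mulrA divff ?gt_eqF// mul1r.
  have := sqr_ge0 (u - delta); nra.
Qed.

End wasserstein_fibre.

(** * Integration against finite combinations of measures *)

Section combinations.
Context d (T : measurableType d) (R : realType).
Local Open Scope ereal_scope.

Lemma ge0_integral_combination n (c : 'I_n -> R) (nu : 'I_n -> probability T R)
    (mu : {measure set T -> \bar R}) (D : set T) (phi : T -> \bar R) :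
  (forall i, (0 <= c i)%R) ->
  (forall A, measurable A -> mu A = \sum_(i < n) (c i)%:E * nu i A) ->
  measurable D -> measurable_fun D phi -> (forall x, D x -> 0 <= phi x) ->
  \int[mu]_(x in D) phi x = \sum_(i < n) (c i)%:E * \int[nu i]_(x in D) phi x.
Proof.
move=> c0 muE mD mphi phi0.
(* The finite family is prolonged to all naturals by the zero measure, as [msum] takes sequences of
   measures. *)
pose m_ (k : nat) : {measure set T -> \bar R} :=
  if insub k is Some i then mscale (NngNum (c0 i)) (nu i) else mzero.
have m_E (i : 'I_n) : m_ i = mscale (NngNum (c0 i)) (nu i) by rewrite /m_ valK.
rewrite (@eq_measure_integral _ _ _ _ (msum m_ n)); last first.
  by move=> A mA _; rewrite muE//= /msum; apply: eq_bigr => i _; rewrite m_E.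
rewrite ge0_integral_measure_sum//; apply: eq_bigr => i _.
by rewrite m_E ge0_integral_mscale.
Qed.

(** Adding the bound [C] makes [phi] nonnegative; the nonnegative case applies to [phi + C] and to
    [C], and the results are subtracted. *)
Lemma Rintegral_combination n (c : 'I_n -> R) (nu : 'I_n -> probability T R)
    (mu : probability T R) (D : set T) (phi : T -> R) (C : R) :
  (forall i, (0 <= c i)%R) ->
  (forall A, measurable A -> mu A = \sum_(i < n) (c i)%:E * nu i A) ->
  measurable D -> measurable_fun D phi ->
  (forall x, D x -> (`|phi x| <= C)%R) ->
  (\int[mu]_(x in D) phi x = \sum_(i < n) c i * \int[nu i]_(x in D) phi x)%R.
Proof.
move=> c0 muE mD mphi bphi.
have int_bounded (P : probability T R) (psi : T -> R) : measurable_fun D psi ->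
    (exists M, forall x, D x -> (`|psi x| <= M)%R) ->
    P.-integrable D (EFin \o psi).
  move=> mpsi [M hM]; apply: measurable_bounded_integrable => //.
    by apply: le_lt_trans (ltry 1); exact: probability_le1.
  exists M; split => [|M' MM' x /hM xM]; first exact: num_real.
  exact: le_trans (ltW MM').
have icst (P : probability T R) : P.-integrable D (EFin \o cst C).
  by apply: int_bounded; [exact: measurable_cst|exists `|C|%R].
have iphi (P : probability T R) : P.-integrable D (EFin \o phi).
  by apply: int_bounded => //; exists C.
have shift (P : probability T R) : (\int[P]_(x in D) phi x =
    \int[P]_(x in D) (phi x + C) - \int[P]_(x in D) C)%R.
  by rewrite (RintegralD mD (iphi P) (icst P)) addrK.
have ge0 (psi : T -> R) : measurable_fun D psi ->
    (forall P : probability T R, P.-integrable D (EFin \o psi)) ->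
    (forall x, D x -> (0 <= psi x)%R) ->
    (\int[mu]_(x in D) psi x = \sum_(i < n) c i * \int[nu i]_(x in D) psi x)%R.
  move=> mpsi ipsi psi0; rewrite /Rintegral.
  rewrite (ge0_integral_combination c0 muE)//; last exact/measurable_EFinP.
  rewrite -sum_fine => [|i _]; last first.
    by rewrite fin_numM// integrable_fin_num// ipsi.
  by apply: eq_bigr => i _; rewrite fineM// integrable_fin_num// ipsi.
(* An empty [D] is treated apart, since [0 <= C] is read off from a point of [D]. *)
have [D0|/set0P[x0 Dx0]] := eqVneq D set0.
  rewrite D0 Rintegral_set0 big1// => i _.
  by rewrite Rintegral_set0 mulr0.
have C0 : (0 <= C)%R by exact: le_trans (bphi x0 Dx0).
rewrite shift ge0; last 3 first.
- by apply: measurable_funD => //; exact: measurable_cst.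
- move=> P; apply: int_bounded; first by apply: measurable_funD => //; exact: measurable_cst.
  exists (C + C)%R => x Dx; rewrite (le_trans (ler_normD _ _))// lerD ?bphi//.
  by rewrite ger0_norm.
- move=> x Dx; have := bphi x Dx; rewrite ler_norml => /andP[+ _].
  by rewrite -lerBlDr sub0r.
have mC : measurable_fun D (cst C) by exact: measurable_cst.
rewrite (ge0 _ mC icst)//.
rewrite -sumrB; apply: eq_bigr => i _.
by rewrite -mulrBr -shift.
Qed.

End combinations.

(** * Products with a Dirac mass *)

Section dirac_products.
Context d1 d2 (T1 : measurableType d1) (T2 : measurableType d2) (R : realType).
Local Open Scope ereal_scope.

Lemma product_dirac_right (mu : probability T1 R) (b : T2) A : measurable A ->
  (mu \x \d_b) A = mu [set x | A (x, b)].
Proof.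
move=> mA; rewrite /product_measure1/=.
have mAb : measurable [set x | A (x, b)].
  rewrite (_ : [set _ | _] = ysection A b); first exact: measurable_ysection.
  by apply/seteqP; split => x /=; rewrite /ysection/= inE.
transitivity (\int[mu]_x (\1_[set x | A (x, b)] x)%:E); last first.
  by rewrite integral_indic// setIT.
apply: eq_integral => x _.
rewrite /= diracE indicE; congr ((nat_of_bool _)%:R%:E).
by apply/idP/idP; rewrite !inE /xsection/= inE.
Qed.

Lemma product_dirac_left (a : T1) (nu : probability T2 R) A : measurable A ->
  (\d_a \x nu) A = nu [set y | A (a, y)].
Proof.
move=> mA; rewrite /product_measure1 integral_dirac//; last first.
  exact: measurable_fun_xsection.
rewrite diracT mul1e/=; congr (nu _).
by apply/seteqP; split => x /=; rewrite /xsection/= inE.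
Qed.

End dirac_products.

(** * Moments of the initial data *)

Section initial_data.
Context {R : realType}.

Lemma moment_combination n (c : 'I_n -> R) (nu : 'I_n -> probability (state R) R)
    (mu : probability (state R) R) phi : polyfun phi ->
  (forall i, 0 <= c i) ->
  (forall A, measurable A -> mu A = (\sum_(i < n) (c i)%:E * nu i A)%E) ->
  moment mu phi = \sum_(i < n) c i * moment (nu i) phi.
Proof.
move=> pphi c0 muE; have [C hC] := polyfun_bounded pphi.
apply: (Rintegral_combination c0 muE measurable_K _ hC).
exact: polyfun_measurable.
Qed.

Lemma moment_distribution d (T : measurableType d) (P : probability T R)
    (f : {mfun T >-> state R}) phi : polyfun phi ->
  moment (distribution P f) phi = \int[P]_(x in f @^-1` K) phi (f x).
Proof.
move=> pphi; rewrite /moment /Rintegral; congr fine.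
rewrite (@integral_pushforward _ _ _ _ R f _ P K (EFin \o phi))//.
- by apply/measurable_EFinP; exact: polyfun_measurable.
- have mK : measurable (f @^-1` K).
    by rewrite -[X in measurable X]setTI; apply: measurable_funP => //; exact: measurable_K.
  apply: (@measurable_bounded_integrable _ _ _ P (phi \o f)) => //.
  + by apply: le_lt_trans (ltry 1); exact: probability_le1.
  + apply: measurable_funTS; apply: measurableT_comp => //.
    exact: polyfun_measurable.
  + have [C hC] := polyfun_bounded pphi.
    exists C; split => [|M CM x /hC xC]; first exact: num_real.
    exact: le_trans (ltW CM).
- exact: measurable_K.
Qed.

(** [stubborn] is a bare set function. On measurable sets it is the image measure under this map,
    which is a probability and gives access to the change of variables. *)
Definition stubborn_embed (z : R * R) : state R := (z.1, (z.2, 0)).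

Lemma measurable_stubborn_embed : measurable_fun setT stubborn_embed.
Proof. by apply: measurable_fun_pair => //; exact: measurable_fun_pair. Qed.

HB.instance Definition _ :=
  isMeasurableFun.Build _ _ _ _ stubborn_embed measurable_stubborn_embed.

Definition atom_embed (y : R * R) (w : R) : state R := (w, y).

Lemma measurable_atom_embed y : measurable_fun setT (atom_embed y).
Proof. exact: measurable_fun_pair. Qed.

HB.instance Definition _ y :=
  isMeasurableFun.Build _ _ _ _ (atom_embed y) (measurable_atom_embed y).

Lemma stubbornE (f00 : probability (R * R)%type R) A : measurable A ->
  stubborn f00 A = distribution f00 stubborn_embed A.
Proof.
move=> mA; rewrite /stubborn /pushforward product_dirac_right//.
rewrite -[X in measurable X]setTI.
have : measurable_fun setT (fun z : R * R * R => (z.1.1, (z.1.2, z.2))).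
  apply: measurable_fun_pair.
    exact: (measurableT_comp measurable_fst measurable_fst).
  apply: measurable_fun_pair => //.
  exact: (measurableT_comp measurable_snd measurable_fst).
by apply.
Qed.

Lemma moment_stubborn (f00 : probability (R * R)%type R) phi : polyfun phi ->
  moment (distribution f00 stubborn_embed) phi =
  \int[f00]_(z in Kwp) phi (z.1, (z.2, 0)).
Proof.
move=> pphi; rewrite moment_distribution//.
rewrite (_ : stubborn_embed @^-1` K = Kwp)//.
apply/seteqP; split => z /=.
  by move=> [zw [zp _]].
by move=> [zw zp]; split => //; split => //=; rewrite in_itv/= lexx ler01.
Qed.

Lemma moment_stubborn_mixture (a : R) (f00 : probability (R * R)%type R)
    (f01 f0 : probability (state R) R) phi : 0 <= a <= 1 -> polyfun phi ->
  (forall A, measurable A ->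
    f0 A = (a%:E * stubborn f00 A + (1 - a)%:E * f01 A)%E) ->
  moment f0 phi = a * \int[f00]_(z in Kwp) phi (z.1, (z.2, 0))
    + (1 - a) * moment f01 phi.
Proof.
move=> /andP[a0 a1] pphi f0E.
(* The two-term mixture is a combination indexed by ['I_2], with the stubborn part at index 0. *)
pose c (i : 'I_2) := if i == ord0 then a else 1 - a.
pose stub : probability (state R) R := distribution f00 stubborn_embed.
pose nu (i : 'I_2) := if i == ord0 then stub else f01.
rewrite (@moment_combination 2 c nu)//.
- by rewrite !big_ord_recl big_ord0 addr0 /c /nu/= moment_stubborn.
- by move=> i; rewrite /c; case: ifP => // _; rewrite subr_ge0.
- move=> A mA; rewrite f0E// !big_ord_recl big_ord0 adde0 /c /nu/=.
  by rewrite stubbornE.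
Qed.

Lemma moment_atomic_mixture N (alpha p q : 'I_N -> R)
    (alpha_gt0 : forall i, 0 < alpha i) (alpha_sum : \sum_(i < N) alpha i = 1)
    (g : 'I_N -> probability R R) (h : R * R -> R) :
  (forall i, 0 <= p i <= 1) -> (forall i, 0 <= q i <= 1) ->
  (forall i, prob_on Kw (g i)) -> polyfun (fun x => h x.2) ->
  moment (mixture (fun i => g i \x \d_(p i, q i))%E alpha_gt0 alpha_sum)
    (fun x => h x.2) = \sum_(i < N) alpha i * h (p i, q i).
Proof.
move=> hp hq hg ph.
rewrite (@moment_combination _ alpha (fun i => g i \x \d_(p i, q i))%E)//; last first.
  by move=> i; exact: ltW.
apply: eq_bigr => i _; congr (_ * _).
transitivity (moment (distribution (g i) (atom_embed (p i, q i))) (fun x => h x.2)).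
  rewrite /moment /Rintegral; congr fine; apply: eq_measure_integral => A mA _.
  exact: product_dirac_right.
(* As [(p i, q i)] lies in the unit square, the fibre of [K] over it is all of [Kw]. *)
rewrite moment_distribution//= (_ : _ @^-1` K = Kw).
  rewrite Rintegral_cst; last exact: measurable_itv.
  by transitivity (h (p i, q i) * fine 1%E); [congr (_ * fine _); exact: hg|rewrite mulr1].
apply/seteqP; split => w /=; first by case.
by move=> hw; split => //; split => /=; rewrite in_itv/= ?hp ?hq.
Qed.

End initial_data.

(** Induction on the list of nodes: the correction [(q i)^-1 * (1 - y * r y)] is 0 at the nodes
    already treated and repairs the equation at [q i]. *)
Lemma polyfun_inverse_at_nodes (R : realType) N (q : 'I_N -> R) :
  (forall i, q i != 0) -> exists r : R -> R,
    polyfun (fun x : state R => r x.2.2) /\ forall i, q i * r (q i) = 1.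
Proof.
move=> q0.
suff [r [pr rq]] : exists r : R -> R, polyfun (fun x : state R => r x.2.2) /\
    forall i, i \in enum 'I_N -> q i * r (q i) = 1.
  by exists r; split => // i; apply: rq; rewrite mem_enum.
elim: (enum 'I_N) => [|i s [r [pr IHr]]].
  by exists (fun=> 0); split.
exists (fun y => r y + (q i)^-1 * (1 - y * r y)); split; first by auto 10.
move=> j; rewrite inE => /predU1P[->|/IHr qrj].
  by have := q0 i => ?; field.
by rewrite qrj subrr mulr0 addr0.
Qed.

(** * The mean expressed through the non-stubborn part *)

Section dynamics.
Context {R : realType} (a0 eps : R) (ha0 : 0 < a0 <= 1) (heps : 0 < eps).
Context (f00 : probability (R * R)%type R).
Context (N : nat) (alpha p q : 'I_N -> R).
Hypothesis alpha_gt0 : forall i, 0 < alpha i.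
Hypothesis hq : forall i, eps <= q i <= 1.
Hypothesis hp : forall i, 0 < p i <= 1.
Context (f01 f0 : probability (state R) R) (f f1 : R -> probability (state R) R).
Hypothesis f01_atomic : forall h : R * R -> R, polyfun (fun x => h x.2) ->
  moment f01 (fun x => h x.2) = \sum_(i < N) alpha i * h (p i, q i).

Let S (phi : state R -> R) : R := \int[f00]_(z in Kwp) phi (z.1, (z.2, 0)).

Hypothesis f0E : forall phi, polyfun phi ->
  moment f0 phi = a0 * S phi + (1 - a0) * moment f01 phi.
Hypotheses (hf : transport_solution f0 f) (hf1 : non_stubborn_part f0 f f01 f1).

Let p00 : R := \int[f00]_(z in Kwp) z.2.
Hypothesis p00_gt0 : 0 < p00.

Context (m00 : R).
Hypothesis m00E : S (fun x => (x.1 - m00) * x.2.1) = 0.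

Let P := mean_p f0.
Let m := mean_w f0 f.
Let p1 := \sum_(i < N) alpha i * p i.

Let p1_ge0 : 0 <= p1.
Proof.
apply: sumr_ge0 => i _; rewrite mulr_ge0 ?ltW//.
by have /andP[] := hp i.
Qed.

Let PE : P = a0 * p00 + (1 - a0) * p1.
Proof.
rewrite /P -[LHS]/(moment f0 (fun x => x.2.1)) f0E//; congr (_ + _ * _).
exact: (f01_atomic (h := fst) polyfun_p).
Qed.

Let P_gt0 : 0 < P.
Proof.
have /andP[a0_gt0 a0_le1] := ha0.
by rewrite PE ltr_pwDl ?mulr_gt0// mulr_ge0// subr_ge0.
Qed.

Let mE t : m t = P^-1 * moment (f t) (fun x => x.2.1 * x.1).
Proof.
rewrite -momentZ//; last by auto.
by apply: eq_moment => x _; rewrite /P; ring.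
Qed.

Let mc : {within `[0, +oo[, continuous m}.
Proof.
have -> : m = (fun t => P^-1 * moment (f t) (fun x => x.2.1 * x.1)) by exact/funext.
move=> t; apply: cvgM; first exact: cvg_cst.
by apply: (moment_continuous hf); auto.
Qed.

Let f1_atomic (t : R) : 0 <= t -> forall h : R * R -> R, polyfun (fun x => h x.2) ->
  moment (f1 t) (fun x => h x.2) = \sum_(i < N) alpha i * h (p i, q i).
Proof. by move=> t0 h ph; rewrite (moment_conserved hf1)// f01_atomic. Qed.

Let f1K (t : R) : 0 <= t -> prob_on K (f1 t).
Proof. exact: prob_on_solution hf1 t. Qed.

(* The moment of (w - m00) p H(q) under f_t - (1 - a0) f1_t. *)
Let D (H : R -> R) t :=
  moment (f t) (fun x => (x.1 - m00) * (x.2.1 * H x.2.2)) -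
  (1 - a0) * moment (f1 t) (fun x => (x.1 - m00) * (x.2.1 * H x.2.2)).

Let D_continuous H : polyfun (fun x : state R => H x.2.2) ->
  {within `[0, +oo[, continuous (D H)}.
Proof.
move=> pH; have pwH : polyfun (fun x : state R => (x.1 - m00) * (x.2.1 * H x.2.2)).
  by auto.
move=> t; apply: cvgB; first exact: (moment_continuous hf pwH).
by apply: cvgM; [exact: cvg_cst|exact: (moment_continuous hf1 pwH)].
Qed.

Let D0 H : polyfun (fun x : state R => H x.2.2) ->
  D H 0 = a0 * S (fun x => (x.1 - m00) * (x.2.1 * H x.2.2)).
Proof.
move=> pH; rewrite /D (moment_at0 hf) (moment_at0 hf1) f0E; last by auto.
by rewrite addrK.
Qed.

(** Both moments are conserved, and at time 0 the factor q kills the stubborn contribution. *)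
Let moment_qH_diff (t : R) (h : R * R -> R) : 0 <= t ->
  polyfun (fun x : state R => h x.2) ->
  moment (f t) (fun x => x.2.2 * h x.2) =
  (1 - a0) * moment (f1 t) (fun x => x.2.2 * h x.2).
Proof.
move=> t0 ph; have pqh : polyfun (fun x : state R => x.2.2 * h x.2) by auto.
rewrite (moment_conserved (h := fun y => y.2 * h y) hf)//.
rewrite (moment_conserved (h := fun y => y.2 * h y) hf1)//.
rewrite f0E// (_ : S _ = 0) ?mulr0 ?add0r//.
rewrite /S (@eq_Rintegral _ _ _ _ _ (fun=> 0)) => [|z _]; last exact: mul0r.
by rewrite Rintegral_cst ?mul0r//; exact: measurableX.
Qed.

Let flux_affine (F : R -> probability (state R) R) (h : R * R -> R) t :
  polyfun (fun x : state R => h x.2) ->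
  flux m P F (fun x => (x.1 - m00) * h x.2) t =
  P * ((m t - m00) * moment (F t) (fun x => x.2.2 * h x.2) -
       moment (F t) (fun x => (x.1 - m00) * (x.2.2 * h x.2))).
Proof.
move=> ph; rewrite /flux; congr (_ * _).
rewrite (@eq_moment _ _ _ (fun x => x.2.2 * h x.2)) => [|x _]; last first.
  by rewrite dw_affine.
rewrite (@eq_moment _ _ (fun x => x.1 * (x.2.2 * dw _ x))
    (fun x => (x.1 - m00) * (x.2.2 * h x.2) + m00 * (x.2.2 * h x.2))); last first.
  by move=> x _; rewrite dw_affine//; ring.
by rewrite momentD ?momentZ; auto 10; ring.
Qed.

(** The terms in [m t - m00] cancel by [moment_qH_diff], so the nonlocal coupling disappears from
    the difference: what remains is linear, with q multiplying [H]. *)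
Let D_is_derive H (t : R) : polyfun (fun x : state R => H x.2.2) -> 0 < t ->
  is_derive t 1 (D H) (- P * D (fun y => y * H y) t).
Proof.
move=> pH t0.
pose h y : R := y.1 * H y.2.
have ph : polyfun (fun x : state R => h x.2) by rewrite /h; auto.
have pwH : polyfun (fun x : state R => (x.1 - m00) * (x.2.1 * H x.2.2)) by auto.
have e F : moment F (fun x => (x.1 - m00) * (x.2.2 * h x.2)) =
    moment F (fun x => (x.1 - m00) * (x.2.1 * (x.2.2 * H x.2.2))).
  by apply: eq_moment => x _; rewrite /h/=; ring.
have df := moment_is_derive hf mc pwH t0.
have df1 := moment_is_derive hf1 mc pwH t0.
apply: (is_derive_eq (is_deriveB df (is_deriveZ (1 - a0) df1))).
rewrite /GRing.scale/= -/P -/m (flux_affine f t ph) (flux_affine f1 t ph).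
rewrite (moment_qH_diff (ltW t0) ph) !e /D; ring.
Qed.

Let D_linear H (b t : R) : polyfun (fun x : state R => H x.2.2) ->
  D (fun y => y * H y) t = b * D H t + D (fun y => (y - b) * H y) t.
Proof.
move=> pH; rewrite /D.
have e F : moment F (fun x => (x.1 - m00) * (x.2.1 * (x.2.2 * H x.2.2))) =
    b * moment F (fun x => (x.1 - m00) * (x.2.1 * H x.2.2)) +
    moment F (fun x => (x.1 - m00) * (x.2.1 * ((x.2.2 - b) * H x.2.2))).
  by rewrite -momentZ -?momentD; auto 10; apply: eq_moment => x _; ring.
by rewrite !e; ring.
Qed.

(* [D H] decays at rate [P * b] as soon as [D ((q - b) H)] vanishes, so the
   roots of the annihilating polynomial can be removed one at a time. *)
Let D_peel (s : seq R) H (t : R) : polyfun (fun x : state R => H x.2.2) -> H 0 = 0 ->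
  (forall b, b \in s -> 0 <= b) ->
  (forall t, 0 <= t -> D (fun y => (\prod_(b <- s) (y - b)) * H y) t = 0) ->
  0 <= t -> D H t = 0.
Proof.
move=> + H0; elim: s t => [|b s IHs] t pH s0 Ds t0.
  rewrite -(Ds t t0); congr (D _ t); apply/funext => y.
  by rewrite big_nil mul1r.
pose G y := (\prod_(c <- s) (y - c)) * H y.
have pG : polyfun (fun x : state R => G x.2.2).
  by apply: polyfunM => //; apply: polyfun_prod => c; auto.
apply: IHs => //; first by move=> c cs; apply: s0; rewrite inE cs orbT.
rewrite -/G; apply: (@linear_ode_eq0 _ (D G) (P * b)).
- by rewrite mulr_ge0 ?(ltW P_gt0)// s0// mem_head.
- exact: D_continuous.
- move=> r r0; apply: is_derive_eq (D_is_derive pG r0) _.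
  rewrite (D_linear b)// (_ : (fun y => (y - b) * G y) =
      fun y => (\prod_(c <- b :: s) (y - c)) * H y); last first.
    by apply/funext => y; rewrite big_cons /G mulrA.
  by rewrite Ds ?ltW// addr0; ring.
(* The initial value is an integral over stubborn agents, for whom q = 0, and [H 0 = 0]. *)
- rewrite D0// (_ : S _ = 0) ?mulr0//.
  rewrite /S (@eq_Rintegral _ _ _ _ _ (fun=> 0)) => [|z _]; last first.
    by rewrite /G H0 !mulr0.
  by rewrite Rintegral_cst ?mul0r//; exact: measurableX.
Qed.

Let q_ge0 i : 0 <= q i.
Proof. by have /andP[+ _] := hq i; apply: le_trans; exact: ltW. Qed.

(** Both [f t] and [f1 t] have q in {0, q_1, ..., q_N} almost surely, so q times the product of the
    q - q_i vanishes there. This is detected by the conserved moment of its square; [D_peel] then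
    removes the factors q - q_i and leaves q. *)
Let D_q (t : R) : 0 <= t -> D id t = 0.
Proof.
apply: (@D_peel [seq q i | i <- enum 'I_N]) => //.
  by move=> _ /mapP[i _ ->]; exact: q_ge0.
move=> {}t t0.
set H := fun y : R => _.
have pH : polyfun (fun x : state R => H x.2.2).
  by apply: polyfunM => //; apply: polyfun_prod => c; auto.
have Hq i : H (q i) = 0.
  rewrite /H big_map (bigD1_seq i) ?mem_enum ?enum_uniq//=.
  by rewrite subrr !mul0r.
have pH2 : polyfun (fun x : state R => H x.2.2 ^+ 2) by auto.
have f1H : moment (f1 t) (fun x => H x.2.2 ^+ 2) = 0.
  rewrite (f1_atomic t0 (h := fun y => H y.2 ^+ 2))//.
  by rewrite big1// => i _; rewrite Hq expr0n mulr0.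
have fH : moment (f t) (fun x => H x.2.2 ^+ 2) = 0.
  rewrite (moment_conserved (h := fun y => H y.2 ^+ 2) hf)// f0E//.
  rewrite (f01_atomic (h := fun y => H y.2 ^+ 2))//.
  rewrite big1 => [|i _]; last by rewrite Hq expr0n mulr0.
  rewrite mulr0 addr0 (_ : S _ = 0) ?mulr0//.
  rewrite /S (@eq_Rintegral _ _ _ _ _ (fun=> 0)) => [|z _]; last first.
    by rewrite /H mulr0 expr0n.
  by rewrite Rintegral_cst ?mul0r//; exact: measurableX.
have wpH F : moment F (fun x => H x.2.2 ^+ 2) = 0 ->
    moment F (fun x => (x.1 - m00) * (x.2.1 * H x.2.2)) = 0.
  move=> FH; rewrite -[RHS](moment_mul_eq0 (phi := fun x => (x.1 - m00) * x.2.1) _ pH FH).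
    by apply: eq_moment => x _; rewrite mulrA.
  by auto.
by rewrite /D !wpH// mulr0 subr0.
Qed.

(** By [D_q] its derivative is 0, and its initial value is the centred moment of the stubborn
    agents, null by the choice of [m00]. The rate being 0 here, this last step needs the initial
    value, unlike a decay argument. *)
Let D_1 (t : R) : 0 <= t -> D (fun=> 1) t = 0.
Proof.
move=> t0; transitivity (D (fun=> 1) 0); last first.
  rewrite D0// (_ : S _ = 0) ?mulr0// -[RHS]m00E.
  by apply: eq_Rintegral => z _; rewrite mulr1.
apply: constant_half_line => //; first exact: D_continuous.
move=> r r0; apply: is_derive_eq (D_is_derive (polyfun_cst 1) r0) _.
rewrite (_ : (fun y => y * 1) = id) ?D_q ?ltW ?mulr0//.
by apply/funext => y; rewrite mulr1.
Qed.

(** * Decay of the energy *)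

Let Y t := moment (f1 t) (fun x => x.2.1 * (x.1 - m00)).
Let Z t := moment (f1 t) (fun x => x.2.1 * (x.1 - m00) ^+ 2).

(** This is [D_1] read through the definition of [m], together with the conservation of the mean of
    p. *)
Let mean_w_deviation (t : R) : 0 <= t -> P * (m t - m00) = (1 - a0) * Y t.
Proof.
move=> t0; have := D_1 t0; rewrite /D => /subr0_eq.
have e F : moment F (fun x => (x.1 - m00) * (x.2.1 * 1)) =
    moment F (fun x => x.2.1 * (x.1 - m00)).
  by apply: eq_moment => x _; ring.
rewrite !e -/(Y t) => <-.
rewrite mE mulrBr mulrA divff ?gt_eqF// mul1r.
have -> : P = moment (f t) (fun x => x.2.1).
  by rewrite (moment_conserved (h := fst) hf).
rewrite mulrC -momentZ// -momentB; [|by auto|by auto].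
by apply: eq_moment => x _; ring.
Qed.

Let Y2_le (t : R) : 0 <= t -> Y t ^+ 2 <= p1 * Z t.
Proof.
move=> t0.
have := @moment_cauchy_schwarz _ (f1 t) (fun x => x.2.1) (fun=> 1) (fun x => x.1 - m00).
have -> : moment (f1 t) (fun x => x.2.1 * (1 * (x.1 - m00))) = Y t.
  by apply: eq_moment => x _; ring.
have -> : moment (f1 t) (fun x => x.2.1 * 1 ^+ 2) = p1.
  rewrite -[RHS](f1_atomic t0 (h := fst) polyfun_p).
  by apply: eq_moment => x _; rewrite expr1n mulr1.
apply; auto.
by move=> x [_ [/=]]; rewrite in_itv/= => /andP[].
Qed.

Context (r : R -> R).
Hypothesis pr : polyfun (fun x : state R => r x.2.2).
Hypothesis qr : forall i, q i * r (q i) = 1.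

(* [r] is a polynomial with [r (q i) = 1 / q i], so that this is the integral
   of (p / q) (w - m00)^2. *)
Definition energy t := moment (f1 t) (fun x => (x.1 - m00) ^+ 2 * (x.2.1 * r x.2.2)).

Let q_gt0 i : 0 < q i.
Proof. by have /andP[+ _] := hq i; apply: lt_le_trans. Qed.

Let r_gt0 i : 0 < r (q i).
Proof. by rewrite -(pmulr_rgt0 _ (q_gt0 i)) qr. Qed.

(** The sign of [r] is known only at the nodes, where it equals 1 / q; these carry [f1 t]. *)
Lemma energy_ge0 (t : R) : 0 <= t -> 0 <= energy t.
Proof.
move=> t0; rewrite /energy -[leLHS](moment_cst 0 (f1K t0)).
apply: (le_moment_atoms (f1_atomic t0)) => //; first by auto.
move=> x i Kx ->/=; rewrite mulr_ge0 ?sqr_ge0// mulr_ge0 ?(ltW (r_gt0 i))//.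
by have /andP[/ltW] := hp i.
Qed.

Lemma energy_decay (t : R) : 0 <= t ->
  (1 + 2 * a0 * p00 * eps * t) * energy t <= energy 0.
Proof.
have /andP[a0_gt0 a0_le1] := ha0.
have pE : polyfun (fun x : state R => (x.1 - m00) ^+ 2 * (x.2.1 * r x.2.2)) by auto.
apply: (@gronwall_decay _ energy (fun t => 2 * (1 - a0) * Y t ^+ 2 - 2 * P * Z t)).
- by rewrite !mulr_ge0// ltW.
- exact: (moment_continuous hf1 pE).
- move=> s s0; apply: is_derive_eq (moment_is_derive hf1 mc pE s0) _.
  rewrite /flux -/P -/m; have s0' := ltW s0.
  have pd : polyfun (fun x : state R => dw
     (fun x => (x.1 - m00) ^+ 2 * (x.2.1 * r x.2.2)) x) by exact: polyfun_derive.
  (* The weight 1 / q in the energy is chosen to cancel the speed factor q of the transport. *)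
  have dE x i : x.2 = (p i, q i) ->
      x.2.2 * dw (fun x => (x.1 - m00) ^+ 2 * (x.2.1 * r x.2.2)) x =
      2 * (x.2.1 * (x.1 - m00)).
    move=> xi; rewrite (@dw_quadratic _ _ (fun y => y.1 * r y.2)) ?xi/=; last by auto.
    by rewrite -[RHS]mulr1 -(qr i); ring.
  rewrite (@eq_moment_atoms _ _ _ _ _ _ (f1_atomic s0') _
     (fun x => 2 * (x.2.1 * (x.1 - m00)))); last 3 first.
  + by auto.
  + by auto.
  + by move=> x i _ /dE.
  rewrite (@eq_moment_atoms _ _ _ _ _ _ (f1_atomic s0') (fun x => x.1 * _)
     (fun x => 2 * (x.2.1 * (x.1 - m00) ^+ 2) +
       2 * m00 * (x.2.1 * (x.1 - m00)))); last 3 first.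
  + by auto.
  + by auto 10.
  + by move=> x i _ /dE ->; ring.
  rewrite momentD ?momentZ; auto 10; rewrite -/(Y s) -/(Z s).
  have := mean_w_deviation s0'.
  set u := m s - m00 => Pu.
  have -> : m s = u + m00 by rewrite /u subrK.
  transitivity (2 * (P * u) * Y s - 2 * P * Z s); first by ring.
  by rewrite Pu; ring.
- exact: energy_ge0.
- move=> s s0; have s0' := ltW s0.
  (* At the nodes [eps * r (q i) <= 1], since [eps <= q i]. *)
  have EZ : eps * energy s <= Z s.
    rewrite -momentZ//; apply: (le_moment_atoms (f1_atomic s0')); auto.
    move=> x i Kx xi; rewrite xi/=.
    have /andP[epsq _] := hq i; have /andP[p0 _] := hp i.
    have er : eps * r (q i) <= 1 by rewrite -(qr i) ler_pM2r.
    have : 0 <= p i * (x.1 - m00) ^+ 2 by rewrite mulr_ge0 ?sqr_ge0 ?ltW.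
    move/(ler_wpM2l)/(_ _ _ er); rewrite mulr1; apply: le_trans.
    by rewrite le_eqVlt; apply/orP; left; apply/eqP; ring.
  have Y2 := Y2_le s0'.
  (* After Cauchy-Schwarz the [p1] terms cancel against those of [P]; only the stubborn share
     [a0 * p00] of the dissipation survives. *)
  have : (1 - a0) * Y s ^+ 2 <= (1 - a0) * (p1 * Z s).
    by rewrite ler_wpM2l// subr_ge0.
  have : a0 * p00 * (eps * energy s) <= a0 * p00 * Z s.
    by rewrite ler_wpM2l// ltW// mulr_gt0.
  rewrite PE; lra.
Qed.

(** At a node the weight p / q is at least [p i] because [q i <= 1], and [p i] is at least the
    product of all [p j], each being at most 1. The product serves as a uniform positive lower
    bound. *)
Lemma variance_le_energy (t : R) : 0 <= t ->
  (\prod_(i < N) p i) * moment (f1 t) (fun x => (x.1 - m00) ^+ 2) <= energy t.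
Proof.
move=> t0; rewrite -momentZ; last by auto.
apply: (le_moment_atoms (f1_atomic t0)); [by auto|by auto|].
move=> x i Kx xi; rewrite xi/= mulrC ler_wpM2l ?sqr_ge0//.
have /andP[p0 _] := hp i; have /andP[_ q1] := hq i.
apply: (@le_trans _ _ (p i)).
  rewrite (bigD1 i)//=; apply: ler_piMr; first exact: ltW.
  apply: numdomain.Num.Theory.prodr_ile1 => j _.
  by have /andP[/ltW -> ->] := hp j.
apply: ler_peMr; first exact: ltW.
by rewrite -(qr i); apply: ler_piMl => //; exact: ltW.
Qed.

End dynamics.

(** * Convergence in Wasserstein distance *)

Theorem mainTheorem2 (R : realType) (alpha0 eps : R)
  (halpha0 : 0 < alpha0 <= 1) (heps : 0 < eps)
  (f00 : probability (R * R)%type R)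
  (hf00 : prob_on Kwp f00)
  (N : nat) (alpha : 'I_N -> R)
  (alpha_gt0 : forall i, 0 < alpha i)
  (alpha_sum : \sum_(i < N) alpha i = 1)
  (q : 'I_N -> R) (hq : forall i, eps <= q i <= 1) (q_inj : injective q)
  (p : 'I_N -> R) (hp : forall i, 0 < p i <= 1)
  (g : 'I_N -> probability R R) (hg : forall i, prob_on Kw (g i)) :
  let f01 : probability (state R) R :=
    mixture (fun i => g i \x \d_(p i, q i))%E alpha_gt0 alpha_sum in
  forall (f0 : probability (state R) R)
  (hf0K : prob_on K f0)
  (hf0 : forall A, measurable A ->
    f0 A = (alpha0%:E * stubborn f00 A + (1 - alpha0)%:E * f01 A)%E),
  let p00 := \int[f00]_(z in Kwp) z.2 in
  let m00 := p00^-1 * \int[f00]_(z in Kwp) (z.2 * z.1) in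
  0 < p00 ->
  forall (f : R -> probability (state R) R) (hf : transport_solution f0 f)
  (f1 : R -> probability (state R) R) (hf1 : non_stubborn_part f0 f f01 f1),
  W1 (f1 t)
     (\d_m00 \x mixture (fun i => \d_(p i, q i)) alpha_gt0 alpha_sum)%E
    @[t --> +oo] --> 0%E.
Proof.
move=> f01 f0 hf0K hf0 p00 m00 p00_gt0 f hf f1 hf1.
have /andP[a0_gt0 a0_le1] := halpha0.
have q_gt0 i : 0 < q i by have /andP[+ _] := hq i; apply: lt_le_trans.
have p01 i : 0 <= p i <= 1 by have /andP[/ltW -> ->] := hp i.
have q01 i : 0 <= q i <= 1 by rewrite ltW//=; have /andP[] := hq i.
have f01_atomic (h : R * R -> R) : polyfun (fun x => h x.2) ->
    moment f01 (fun x => h x.2) = \sum_(i < N) alpha i * h (p i, q i).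
  by move=> ph; exact: moment_atomic_mixture.
have f0E phi : polyfun phi -> moment f0 phi =
    alpha0 * \int[f00]_(z in Kwp) phi (z.1, (z.2, 0)) + (1 - alpha0) * moment f01 phi.
  by move=> pphi; apply: moment_stubborn_mixture => //; rewrite ltW.
(* The integral is lifted to a moment on the state space, where linearity for polynomials is
   available. *)
have m00E : \int[f00]_(z in Kwp) ((z.1 - m00) * z.2) = 0.
  pose stub : probability (state R) R := distribution f00 stubborn_embed.
  transitivity (moment stub (fun x => (x.1 - m00) * x.2.1)).
    by rewrite /stub moment_stubborn; auto.
  rewrite (@eq_moment _ _ _ (fun x => x.2.1 * x.1 - m00 * x.2.1)); last first.
    by move=> x _; ring.
  rewrite momentB ?momentZ; auto.
  rewrite /stub !moment_stubborn; auto => /=.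
  rewrite -/p00 /m00 mulrAC mulVf ?mul1r ?subrr//.
  by rewrite gt_eqF.
have [|r [pr qr]] := @polyfun_inverse_at_nodes R N q.
  by move=> i; rewrite gt_eqF.
pose E := energy f1 m00 r.
pose pm := \prod_(i < N) p i.
have pm_gt0 : 0 < pm by apply: prodr_gt0 => i _; have /andP[] := hp i.
pose c := 2 * alpha0 * p00 * eps.
have c_gt0 : 0 < c by rewrite !mulr_gt0.
have E_decay t : 0 <= t -> (1 + c * t) * E t <= E 0.
  exact: (energy_decay halpha0 heps alpha_gt0 hq hp f01_atomic f0E hf hf1 p00_gt0 m00E pr qr).
have V_le t : 0 <= t -> pm * moment (f1 t) (fun x => (x.1 - m00) ^+ 2) <= E t.
  exact: (variance_le_energy heps hq hp f01_atomic hf1 m00 pr qr).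
pose nu : probability (state R) R :=
  (\d_m00 \x mixture (fun i => \d_(p i, q i)) alpha_gt0 alpha_sum)%E.
(* The (p, q)-marginal of [f1 t] is conserved and atomic, so the target is the image of [f1 t] under
   the collapse of w to [m00]. *)
have nuE t : 0 <= t -> forall A, measurable A ->
    nu A = f1 t [set x | A (m00, x.2)].
  move=> t0 A mA; rewrite [LHS]product_dirac_left//.
  rewrite (@snd_marginal _ _ alpha p q (f1 t) _ _ q_inj [set y | A (m00, y)])//.
  - exact: (prob_on_solution hf1).
  - by move=> h ph; rewrite (moment_conserved hf1)// f01_atomic.
  - rewrite (_ : [set _ | _] = xsection A m00); first exact: measurable_xsection.
    by apply/seteqP; split => y /=; rewrite /xsection/= inE.
have W1_le t delta : 0 <= t -> 0 < delta ->
    (W1 (f1 t) nu <= (delta + E 0 / (delta * pm * (1 + c * t)))%:E)%E.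
  move=> t0 d0; have ct : 0 < 1 + c * t by rewrite ltr_pwDl// mulr_ge0// ltW.
  apply: (le_trans (W1_fibre (prob_on_solution hf1 t0) d0 (nuE t t0))).
  rewrite lee_fin lerD2l ler_pdivlMr ?mulr_gt0//.
  set V := moment _ _.
  have -> : delta^-1 * V * (delta * pm * (1 + c * t)) = (1 + c * t) * (pm * V).
    by field; rewrite gt_eqF.
  by rewrite (le_trans _ (E_decay t t0))// ler_pM2l// V_le.
(* [W1] takes extended real values: eventual finiteness comes first, then convergence of the real
   parts. *)
rewrite -/nu; apply/fine_cvgP; split.
  near=> t.
  have t0 : 0 <= t by [].
  rewrite ge0_fin_numE ?W1_ge0//.
  by rewrite (le_lt_trans (W1_le t 1 t0 ltr01))// ltry.
apply/cvgrPdist_le => e e0.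
near=> t.
have t0 : 0 <= t by [].
have d0 : 0 < e / 2 by rewrite divr_gt0.
have W := W1_le t (e / 2) t0 d0.
rewrite sub0r normrN ger0_norm ?fine_ge0 ?W1_ge0//=.
rewrite -lee_fin fineK; last first.
  by rewrite ge0_fin_numE ?W1_ge0// (le_lt_trans W)// ltry.
apply: (le_trans W); rewrite lee_fin [leRHS](splitr e) lerD2l.
have ct : 0 < 1 + c * t by rewrite ltr_pwDl// mulr_ge0// ltW.
rewrite ler_pdivrMr ?mulr_gt0//.
(* For such t the second term of the bound with [delta = e / 2] is at most [e / 2]; the threshold
   comes from bounding [1 + c * t] below by [c * t]. *)
have : E 0 / (e / 2 * pm * c * (e / 2)) <= t by [].
rewrite ler_pdivrMr ?mulr_gt0// => /le_trans; apply.
have := mulr_gt0 (mulr_gt0 d0 d0) pm_gt0.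
nra.
Unshelve. all: by end_near. Qed.
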